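(* Let $q$ be a prime power with $q-1>2$ and let $a,b$ be integers with $1\le a\le b\le q$. Suppose that the code $C(q-1,a,b)$ belongs to group (G2), i.e. $$q^2-q-2\le (q-1)(q+1)-a-b\le (q^2-q-2)+q$$ and the divisor $(q-1)(q+1)P_\infty-aP_\infty-bP_0$ on $X$ is linearly equivalent neither to an integer multiple of $P_\infty$ nor to an integer multiple of $P_0$. Let $\delta$ be the minimum distance of the dual code $C(q-1,a,b)^\perp$ and let $\{P_1,\dots,P_\delta\}\subseteq B$ be the support of a minimum-weight codeword of $C(q-1,a,b)^\perp$. Then one of the following cases occurs: (a) $P_1,\dots,P_\delta$ lie on the line through $P_0$ and $P_\infty$; (b) $P_\infty,P_1,\dots,P_\delta$ are collinear; (c) $P_0,P_1,\dots,P_\delta$ are collinear.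
   Context: Let $q$ be a prime power, $\mathbb{P}^2$ the projective plane over $\mathbb{F}_{q^2}$ with coordinates $(x:y:z)$, and $X\subseteq\mathbb{P}^2$ the Hermitian curve, with affine equation $y^q+y=x^{q+1}$; it is a smooth plane curve of degree $q+1$ with $q^3+1$ $\mathbb{F}_{q^2}$-rational points, and its canonical divisors have degree $q^2-q-2$. Let $P_\infty=(0:1:0)$ and $P_0=(0:0:1)$, both in $X(\mathbb{F}_{q^2})$, and $B:=X(\mathbb{F}_{q^2})\setminus\{P_\infty,P_0\}$. For integers $d>0$ and $0\le a,b\le q$, let $E:=aP_\infty+bP_0$, viewed as a zero-dimensional subscheme of $\mathbb{P}^2$, and let $C(d,a,b)\subseteq\mathbb{F}_{q^2}^{\,|B|}$ be the linear code obtained by evaluating the vector space $H^0(X,\mathcal{O}_X(d)(-E))$ at the points of $B$. Equivalently, one evaluates the homogeneous forms of degree $d$ over $\mathbb{F}_{q^2}$ that vanish on the scheme $E$ at fixed coordinate representatives of the points of $B$; a different choice of representatives multiplies the code coordinatewise by a vector with nonzero entries, which changes neither the minimum distance of the dual code nor the supports of its codewords. $C^\perp$ denotes the dual code, and the support of a codeword is identified with the corresponding subset of $B$. Minimum-weight codewords are nonzero codewords of minimum Hamming weight. *)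

(* Defs.v *)
From mathcomp Require Import all_boot all_order all_algebra.
From mathcomp Require Import mpoly.

Set Implicit Arguments.
Unset Strict Implicit.
Unset Printing Implicit Defensive.

Import GRing.Theory.
Local Open Scope ring_scope.

(* Points of the projective plane over L are represented by the unique
   coordinate vector whose last nonzero entry is 1.  The coordinates x, y, z
   have indices 0, 1, 2. *)
Definition normalized (L : fieldType) (v : 'rV[L]_3) : bool :=
  [exists i : 'I_3,
     (v 0 i == 1) && [forall j : 'I_3, (i < j)%N ==> (v 0 j == 0)]].

Definition P2 (L : fieldType) : Type := {v : 'rV[L]_3 | normalized v}.

Definition evalP (L : fieldType) (f : {mpoly L[3]}) (P : P2 L) : L :=
  f.@[(val P) 0].

Lemma normalized_delta (L : fieldType) (i : 'I_3) :
  normalized (delta_mx 0 i : 'rV[L]_3).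
Proof.
apply/existsP; exists i; rewrite mxE !eqxx /=.
apply/forallP => j; apply/implyP => ltij.
by rewrite mxE eqxx /= -val_eqE /= gtn_eqF.
Qed.

(* (0 : 1 : 0) and (0 : 0 : 1) *)
Definition Pinf (L : fieldType) : P2 L := Sub (delta_mx 0 1) (normalized_delta L 1).
Definition P0 (L : fieldType) : P2 L :=
  Sub (delta_mx 0 ord_max) (normalized_delta L ord_max).

(* Homogenization of y^q + y = x^(q+1). *)
Definition hermitian_curve (L : fieldType) (q : nat) : {mpoly L[3]} :=
  'X_1 ^+ q * 'X_ord_max + 'X_1 * 'X_ord_max ^+ q - 'X_0 ^+ q.+1.

Definition on_X (L : fieldType) (q : nat) (P : P2 L) : bool :=
  evalP (hermitian_curve L q) P == 0.

(* The n-th power of the homogeneous ideal of P, which is generated by the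
   linear forms vanishing at P. *)
Inductive point_ideal_pow (L : fieldType) (P : P2 L) :
    nat -> {mpoly L[3]} -> Prop :=
| PIP_zero f : point_ideal_pow P 0 f
| PIP_mul n l f : l \is 1.-homog -> evalP l P = 0 ->
    point_ideal_pow P n f -> point_ideal_pow P n.+1 (l * f)
| PIP_add n f g : point_ideal_pow P n f -> point_ideal_pow P n g ->
    point_ideal_pow P n (f + g).

(* The form f vanishes on the divisor nP of X, seen as a closed subscheme of
   the plane.  The ideal of nP in the local ring of the plane at P is generated
   by the equation of X and the n-th power of the maximal ideal; multiplying by
   a form g with g(P) <> 0 clears denominators. *)
Definition vanishes_at (L : fieldType) (q : nat) (f : {mpoly L[3]}) (P : P2 L)
    (n : nat) : Prop :=
  exists (e : nat) (g u r : {mpoly L[3]}),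
    [/\ g \is e.-homog, evalP g P != 0, point_ideal_pow P n r &
        g * f = u * hermitian_curve L q + r].

(* The order of vanishing at P of the restriction of f to X is n. *)
Definition order_at (L : fieldType) (q : nat) (f : {mpoly L[3]}) (P : P2 L)
    (n : nat) : Prop :=
  vanishes_at q f P n /\ ~ vanishes_at q f P n.+1.

Definition zero_on_X (L : fieldType) (q : nat) (f : {mpoly L[3]}) : Prop :=
  exists u : {mpoly L[3]}, f = u * hermitian_curve L q.

(* Divisors of X supported at F-rational points, written as functions giving
   the coefficient of each point; the support is meant to lie in X. *)
Definition point_div (F : finFieldType) (P : P2 F) : {ffun P2 F -> int} :=
  [ffun Q => (Q == P)%:Z].

(* D - D' is the divisor of the rational function f/g on X, defined over F.
   As F is finite, every closed point of X is the Galois orbit of a point over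
   a finite extension of F, and its residue field is separable over F, so the
   order of a form at a closed point is its order at any point of the orbit.
   The sum has at most one term: the coefficient at P of D - D'. *)
Definition lin_equiv (F : finFieldType) (q : nat) (D D' : {ffun P2 F -> int}) :
    Prop :=
  exists (n : nat) (f g : {mpoly F[3]}),
    [/\ f \is n.-homog, g \is n.-homog, ~ zero_on_X q f, ~ zero_on_X q g &
      forall (L : finFieldType) (iota : {rmorphism F -> L}) (P : P2 L),
        on_X q P ->
        exists i j : nat,
          [/\ order_at q (map_mpoly iota f) P i,
              order_at q (map_mpoly iota g) P j &
              i%:Z - j%:Z =
                \sum_(Q : P2 F | map_mx iota (val Q) == val P) (D Q - D' Q)]].

Definition B (F : finFieldType) (q : nat) : {set P2 F} :=
  [set P | [&& on_X q P, P != Pinf F & P != P0 F]].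

Definition Bpoint (F : finFieldType) (q : nat) : finType := {P : P2 F | P \in B F q}.

Definition word (F : finFieldType) (q : nat) : Type := {ffun Bpoint F q -> F}.

Definition code (F : finFieldType) (q d a b : nat) (c : word F q) : Prop :=
  exists f : {mpoly F[3]},
    [/\ f \is d.-homog, vanishes_at q f (Pinf F) a, vanishes_at q f (P0 F) b &
        forall P : Bpoint F q, c P = evalP f (val P)].

Definition dual (F : finFieldType) (q : nat) (C : word F q -> Prop)
    (c : word F q) : Prop :=
  forall w : word F q, C w -> \sum_(P : Bpoint F q) c P * w P = 0.

Definition supp (F : finFieldType) (q : nat) (c : word F q) :
    {set Bpoint F q} := [set P | c P != 0].

Definition hamming_dist (F : finFieldType) (q : nat) (c c' : word F q) : nat :=
  #|[set P | c P != c' P]|.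

Definition is_min_distance (F : finFieldType) (q : nat)
    (C : word F q -> Prop) (delta : nat) : Prop :=
  (exists c c' : word F q, [/\ C c, C c', c <> c' & hamming_dist c c' = delta])
  /\ (forall c c' : word F q,
        C c -> C c' -> c <> c' -> (delta <= hamming_dist c c')%N).

Definition min_weight_codeword (F : finFieldType) (q : nat)
    (C : word F q -> Prop) (c : word F q) : Prop :=
  [/\ C c, (exists P, c P != 0) &
      forall c' : word F q, C c' -> (exists P, c' P != 0) ->
        (#|supp c| <= #|supp c'|)%N].

Definition collinear (F : finFieldType) (s : seq (P2 F)) : Prop :=
  exists l : {mpoly F[3]},
    [/\ l \is 1.-homog, l != 0 & forall P, P \in s -> evalP l P = 0].

(* Main.v *)
Require Import Defs.
From mathcomp Require Import all_boot all_order all_algebra finfield.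
From mathcomp Require Import mpoly.
From mathcomp Require Import zify ring.

Set Implicit Arguments.
Unset Strict Implicit.
Unset Printing Implicit Defensive.

Import GRing.Theory.
Local Open Scope ring_scope.

(** The lower bound on the degree says that [a + b <= q + 1]; since [a <= b] and
    [q >= 4], this gives [a <= q - 2].

    A word [c] of the dual code with support [S] satisfies
    [sum_P c_P f(P) = 0] for every form [f] of degree [q - 1] vanishing on the
    scheme [E = a Pinf + b P0].  So no such [f] can vanish on all of [S]
    but one point ([dual_code_eval0]), and the proof consists in writing down
    products of lines that would do so.

    The tangent line [y = 0] of the curve at [P0] has contact [q + 1 >= b]
    there, the tangent line [z = 0] at [Pinf] has contact [q + 1 >= a], and
    neither meets [B].  Hence every form [y z h] with [h] of degree [q - 3]
    vanishes on [E], so that forms [h] of degree at most [q - 3] cannot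
    isolate a point of [S] either ([dual_code_eval0_low]).
    - If [S] had at most [q - 2] points, one line through each of them but one
      would give such an [h]; hence the weight is at least [q - 1]
      ([dual_weight_gt]).
    - The line [x = 0] carries [q - 1] points of [B], and the forms of the
      code restrict there to a space of dimension at most [q - 2], because they
      vanish at [P0] and [Pinf]; this gives a nonzero word of the dual code of
      weight at most [q - 1] ([dual_weight_line]).  So [S] has exactly [q - 1]
      points.
    - If three points of [S] were not collinear, the line through two of them
      and one line through each further point would isolate the third
      with [q - 3] lines; hence [S] lies on a line ([supp_collinear]).
    - If that line missed [Pinf], fix a point [P] of [S] and join [Pinf] to
      each of the other [q - 2] points: these lines avoid [P], and their
      product vanishes to order [q - 2 >= a] at [Pinf].  Multiplied by
      [y], it has degree [q - 1], vanishes on [E] and isolates [P]; so the line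
      contains [Pinf] ([supp_line_Pinf]). *)

(** * Forms, points and lines of the projective plane *)

Lemma ord3P (i : 'I_3) : [\/ i = 0, i = 1 | i = ord_max].
Proof.
by case: i => -[|[|[|//]]] ?; [apply: Or31|apply: Or32|apply: Or33]; apply: val_inj.
Qed.

Lemma evalPD (L : fieldType) (f g : {mpoly L[3]}) P :
  evalP (f + g) P = evalP f P + evalP g P.
Proof. exact: mevalD. Qed.

Lemma evalPN (L : fieldType) (f : {mpoly L[3]}) P : evalP (- f) P = - evalP f P.
Proof. exact: mevalN. Qed.

Lemma evalPM (L : fieldType) (f g : {mpoly L[3]}) P :
  evalP (f * g) P = evalP f P * evalP g P.
Proof. exact: mevalM. Qed.

Lemma evalPZ (L : fieldType) c (f : {mpoly L[3]}) P :
  evalP (c *: f) P = c * evalP f P.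
Proof. exact: mevalZ. Qed.

Lemma evalPXn (L : fieldType) n (f : {mpoly L[3]}) P :
  evalP (f ^+ n) P = evalP f P ^+ n.
Proof. exact: rmorphXn. Qed.

Lemma evalP1 (L : fieldType) (P : P2 L) : evalP 1 P = 1.
Proof. exact: meval1. Qed.

Lemma evalPX (L : fieldType) i (P : P2 L) : evalP 'X_i P = val P 0 i.
Proof. exact: mevalXU. Qed.

Definition evalPE := (@evalPD, @evalPN, @evalPM, @evalPZ, @evalPXn, @evalP1, @evalPX).

Lemma dhomogXi (L : fieldType) (i : 'I_3) : ('X_i : {mpoly L[3]}) \is 1.-homog.
Proof. by rewrite dhomogX /= mdeg1. Qed.

Lemma dhomogXn (L : fieldType) (f : {mpoly L[3]}) d n :
  f \is d.-homog -> f ^+ n \is (d * n).-homog.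
Proof.
move=> hf; elim: n => [|n IH]; first by rewrite muln0 expr0 dhomog1.
by rewrite exprS mulnS; apply: dhomogM.
Qed.

Lemma dhomogXiXn (L : fieldType) (i : 'I_3) n :
  ('X_i ^+ n : {mpoly L[3]}) \is n.-homog.
Proof. by have := dhomogXn n (@dhomogXi L i); rewrite mul1n. Qed.

Lemma dhomog_comb (L : fieldType) (a b : L) d (f g : {mpoly L[3]}) :
  f \is d.-homog -> g \is d.-homog -> a *: f - b *: g \is d.-homog.
Proof. by move=> hf hg; apply: rpredB; apply: rpredZ. Qed.

(** Normalized vectors with vanishing minors are proportional, and the pivot
    entry [1] forces the factor to be [1]. *)
Lemma P2_inj_minors (L : fieldType) (A P : P2 L) :
  (forall i j, val A 0 i * val P 0 j = val A 0 j * val P 0 i) -> A = P.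
Proof.
move=> mAP; apply: val_inj; apply/rowP => k.
have /existsP[i /andP[/eqP Ai /forallP Ai0]] := valP A.
have /existsP[j /andP[/eqP Pj /forallP Pj0]] := valP P.
case: (ltngtP i j) => [ij|ji|/val_inj ij].
- have /eqP Aj := implyP (Ai0 j) ij.
  by have := mAP i j; rewrite Ai Pj Aj mul0r mul1r => /eqP; rewrite oner_eq0.
- have /eqP Pi := implyP (Pj0 i) ji.
  by have := mAP j i; rewrite Ai Pj Pi mulr0 mul1r => /esym/eqP; rewrite oner_eq0.
- by have := mAP k j; rewrite Pj -ij Ai mulr1 mul1r.
Qed.

(** Distinct points have a nonzero minor, say in the coordinates [i, j]; the
    form [A_i X_j - A_j X_i] takes that minor as its value at [P]. *)
Lemma line_separating (L : fieldType) (A P : P2 L) : A != P ->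
  exists l : {mpoly L[3]}, [/\ l \is 1.-homog, evalP l A = 0 & evalP l P != 0].
Proof.
move=> neAP.
have [[i j] nz|all0] := pickP (fun ij : 'I_3 * 'I_3 =>
  val A 0 ij.1 * val P 0 ij.2 - val A 0 ij.2 * val P 0 ij.1 != 0).
  exists (val A 0 i *: 'X_j - val A 0 j *: 'X_i); split.
  - by apply: dhomog_comb; apply: dhomogXi.
  - by rewrite !evalPE; ring.
  - by rewrite !evalPE.
case/eqP: neAP; apply: P2_inj_minors => i j; apply/eqP; rewrite -subr_eq0.
by have := all0 (i, j); rewrite /= => /negbFE.
Qed.

(** The coefficients of the line are the cross product of [A] and [A']. *)
Lemma line_through (L : fieldType) (A A' : P2 L) : A != A' ->
  exists l : {mpoly L[3]},
    [/\ l \is 1.-homog, l != 0, evalP l A = 0 & evalP l A' = 0].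
Proof.
move=> neA; pose m i j := val A 0 i * val A' 0 j - val A 0 j * val A' 0 i.
exists (m 0 1 *: 'X_ord_max - m 0 ord_max *: 'X_1 + m 1 ord_max *: 'X_0); split.
- by apply: rpredD; [apply: dhomog_comb|apply: rpredZ]; apply: dhomogXi.
- apply: contra neA => /eqP l0; apply/eqP/P2_inj_minors => i j.
  have c k := congr1 (mcoeff (U_(k))) l0; move: (c 0) (c 1) (c ord_max).
  rewrite !mcoeffD !mcoeffN !mcoeffZ !mcoeffXU !mcoeff0 /= !mulr0 !mulr1.
  rewrite ?(subr0, sub0r, add0r, addr0, oppr0) => m12 /eqP.
  rewrite oppr_eq0 => /eqP m02 m01.
  case: (ord3P i) (ord3P j) => -> [] -> //; apply/eqP; rewrite -subr_eq0; apply/eqP => //;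
    rewrite -[RHS]oppr0.
  + by rewrite -m01 /m; ring.
  + by rewrite -m02 /m; ring.
  + by rewrite -m12 /m; ring.
- by rewrite !evalPE /m; ring.
- by rewrite !evalPE /m; ring.
Qed.

(** * Vanishing along the divisors of the curve *)

Lemma point_ideal_powMl (L : fieldType) (P : P2 L) n f h :
  point_ideal_pow P n f -> point_ideal_pow P n (h * f).
Proof.
elim=> {n f} [f|n l f hl lP _ IH|n f g _ IHf _ IHg]; first exact: PIP_zero.
  by rewrite mulrCA; apply: PIP_mul.
by rewrite mulrDr; apply: PIP_add.
Qed.

Lemma point_ideal_pow_pred (L : fieldType) (P : P2 L) n f :
  point_ideal_pow P n f -> point_ideal_pow P n.-1 f.
Proof.
elim=> {n f} [f|n l f _ _ hf _|n f g _ IHf _ IHg]; first exact: PIP_zero.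
  exact: point_ideal_powMl.
exact: PIP_add.
Qed.

Lemma point_ideal_pow_le (L : fieldType) (P : P2 L) m n f :
  (m <= n)%N -> point_ideal_pow P n f -> point_ideal_pow P m f.
Proof.
move=> le_mn; rewrite -(subnKC le_mn) addnC; elim: (n - m)%N => [//|k IH].
by move/point_ideal_pow_pred.
Qed.

Lemma point_ideal_pow_exp (L : fieldType) (P : P2 L) n (l : {mpoly L[3]}) :
  l \is 1.-homog -> evalP l P = 0 -> point_ideal_pow P n (l ^+ n).
Proof.
move=> hl lP; elim: n => [|n IH]; first exact: PIP_zero.
by rewrite exprS; apply: PIP_mul.
Qed.

Lemma point_ideal_pow_eval0 (L : fieldType) (P : P2 L) n f :
  point_ideal_pow P n f -> (0 < n)%N -> evalP f P = 0.
Proof.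
elim=> {n f} [//|n l f _ lP _ _ _|n f g _ IHf _ IHg n0].
  by rewrite evalPM lP mul0r.
by rewrite evalPD IHf // IHg // addr0.
Qed.

Lemma vanishes_at_eval0 (L : fieldType) q (f : {mpoly L[3]}) P n :
  on_X q P -> (0 < n)%N -> vanishes_at q f P n -> evalP f P = 0.
Proof.
move=> /eqP PX n0 [e [g [u [r [_ gP hr E]]]]].
have /eqP := congr1 (fun f => evalP f P) E.
rewrite evalPM evalPD evalPM PX mulr0 add0r (point_ideal_pow_eval0 hr n0) mulf_eq0.
by rewrite (negbTE gP) => /eqP.
Qed.

Lemma vanishes_at_pow (L : fieldType) q (f : {mpoly L[3]}) P n :
  point_ideal_pow P n f -> vanishes_at q f P n.
Proof.
move=> hf; exists 0%N, 1, 0, f; split=> //; first exact: dhomog1.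
  by rewrite evalP1 oner_eq0.
by rewrite mul1r mul0r add0r.
Qed.

Lemma vanishes_atMl (L : fieldType) q (f h : {mpoly L[3]}) P n :
  vanishes_at q f P n -> vanishes_at q (h * f) P n.
Proof.
move=> [e [g [u [r [hg gP hr E]]]]]; exists e, g, (h * u), (h * r); split=> //.
  exact: point_ideal_powMl.
by rewrite mulrCA E mulrDr mulrA.
Qed.

(** Up to a factor [g] that does not vanish at [P], the tangent form [f] is
    congruent to [x ^ (q + 1)] modulo the curve, and [x] vanishes at [P]. *)
Lemma vanishes_at_tangent (L : fieldType) q (f g : {mpoly L[3]}) e P n :
  (n <= q.+1)%N -> g \is e.-homog -> evalP g P != 0 -> val P 0 0 = 0 ->
  g * f = hermitian_curve L q + 'X_0 ^+ q.+1 -> vanishes_at q f P n.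
Proof.
move=> nq hg gP P00 E; exists e, g, 1, ('X_0 ^+ q.+1); split=> //.
  apply: (point_ideal_pow_le nq).
  by apply: point_ideal_pow_exp; rewrite ?evalPX // dhomogXi.
by rewrite mul1r.
Qed.

Lemma valPinf (L : fieldType) i : val (Pinf L) 0 i = (i == 1)%:R.
Proof. by rewrite mxE eqxx eq_sym. Qed.

Lemma valP0 (L : fieldType) i : val (P0 L) 0 i = (i == ord_max)%:R.
Proof. by rewrite mxE eqxx eq_sym. Qed.

(** The curve reads [y (y^(q-1) z + z^q) = x^(q+1)]. *)
Lemma vanishes_at_Y (L : fieldType) q n : (1 < q)%N ->
  (n <= q.+1)%N -> vanishes_at q ('X_1 : {mpoly L[3]}) (P0 L) n.
Proof.
case: q => [|[|q]] // _ nq.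
apply: (@vanishes_at_tangent _ _ _
  ('X_1 ^+ q.+1 * 'X_ord_max + 'X_ord_max ^+ q.+2) q.+2 _ _ nq).
- apply: rpredD.
    by have := dhomogM (@dhomogXiXn L 1 q.+1) (@dhomogXi L ord_max); rewrite addn1.
  exact: dhomogXiXn.
- by rewrite !evalPE !valP0 /= expr1n expr0n mul0r add0r oner_eq0.
- by rewrite valP0.
- by rewrite /hermitian_curve !exprS; ring.
Qed.

(** The curve reads [z (y^q + y z^(q-1)) = x^(q+1)]. *)
Lemma vanishes_at_Z (L : fieldType) q n : (1 < q)%N ->
  (n <= q.+1)%N -> vanishes_at q ('X_ord_max : {mpoly L[3]}) (Pinf L) n.
Proof.
case: q => [|[|q]] // _ nq.
apply: (@vanishes_at_tangent _ _ _
  ('X_1 ^+ q.+2 + 'X_1 * 'X_ord_max ^+ q.+1) q.+2 _ _ nq).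
- apply: rpredD.
    exact: dhomogXiXn.
  exact: dhomogM (@dhomogXi L 1) (@dhomogXiXn L ord_max q.+1).
- by rewrite !evalPE !valPinf /= expr1n expr0n mulr0 addr0 oner_eq0.
- by rewrite valPinf.
- by rewrite /hermitian_curve !exprS; ring.
Qed.

Lemma on_X_eq (L : fieldType) q (P : P2 L) : on_X q P =
  (val P 0 1 ^+ q * val P 0 ord_max + val P 0 1 * val P 0 ord_max ^+ q
     == val P 0 0 ^+ q.+1).
Proof. by rewrite /on_X /hermitian_curve !evalPE subr_eq0. Qed.

Lemma Pinf_on_X (L : fieldType) q : (0 < q)%N -> on_X q (Pinf L).
Proof.
by case: q => // q _; rewrite on_X_eq !valPinf /= !expr0n /= !(mulr0, mul0r) addr0.
Qed.

Lemma P0_on_X (L : fieldType) q : (0 < q)%N -> on_X q (P0 L).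
Proof.
by case: q => // q _; rewrite on_X_eq !valP0 /= !expr0n /= !(mulr0, mul0r) addr0.
Qed.

(** On the tangent line [y = 0] the equation of the curve reduces to
    [x ^ (q + 1) = 0], so that it meets the curve at [P0] only. *)
Lemma B_Y_neq0 (F : finFieldType) q (P : Bpoint F q) :
  (0 < q)%N -> evalP 'X_1 (val P) != 0.
Proof.
move=> q0; have := valP P; rewrite inE on_X_eq => /and3P[PX _ PneP0].
rewrite evalPX; apply: contra PneP0 => /eqP P1.
move: PX; rewrite P1 expr0n gtn_eqF // !mul0r addr0 eq_sym expf_eq0 /= => /eqP Px.
apply/eqP/P2_inj_minors => i j; rewrite !valP0.
by case: (ord3P i) (ord3P j) => -> [] ->; rewrite ?P1 ?Px /= ?(mulr0, mul0r).
Qed.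

Lemma B_Z_neq0 (F : finFieldType) q (P : Bpoint F q) :
  (0 < q)%N -> evalP 'X_ord_max (val P) != 0.
Proof.
move=> q0; have := valP P; rewrite inE on_X_eq => /and3P[PX PnePi _].
rewrite evalPX; apply: contra PnePi => /eqP P1.
move: PX; rewrite P1 expr0n gtn_eqF // !mulr0 addr0 eq_sym expf_eq0 /= => /eqP Px.
apply/eqP/P2_inj_minors => i j; rewrite !valPinf.
by case: (ord3P i) (ord3P j) => -> [] ->; rewrite ?P1 ?Px /= ?(mulr0, mul0r).
Qed.

(** One line for each point of [T], none of them through [P].  The predicate [C]
    allows the lines to be chosen through a further point [R], at which their
    product then vanishes to order [size T]. *)
Lemma lines_product (L : fieldType) (R P : P2 L) (C : {mpoly L[3]} -> Prop)
    (T : seq (P2 L)) :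
  (forall Q, Q \in T -> exists l : {mpoly L[3]},
     [/\ l \is 1.-homog, C l, evalP l Q = 0 & evalP l P != 0]) ->
  exists h : {mpoly L[3]},
    [/\ h \is (size T).-homog, {in T, forall Q, evalP h Q = 0}, evalP h P != 0 &
        (forall l, C l -> evalP l R = 0) -> point_ideal_pow R (size T) h].
Proof.
elim: T => [|Q T IH] hT.
  exists 1; split=> //; first exact: dhomog1.
    by rewrite evalP1 oner_eq0.
  by move=> _; exact: PIP_zero.
have [Q' Q'T|h [hh hQ hP hR]] := IH; first by apply: hT; rewrite inE Q'T orbT.
have [l [hl Cl lQ lP]] := hT Q (mem_head _ _).
exists (l * h); split=> /=.
- exact: dhomogM hl hh.
- move=> Q'; rewrite inE evalPM => /orP[/eqP->|/hQ ->]; last by rewrite mulr0.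
  by rewrite lQ mul0r.
- by rewrite evalPM mulf_neq0.
- by move=> CR; apply: PIP_mul; auto.
Qed.

(** * Forms isolating a point of the support *)

Lemma dual_code_sum (F : finFieldType) q d a b (c : word F q) (f : {mpoly F[3]}) :
  dual (@code F q d a b) c -> f \is d.-homog ->
  vanishes_at q f (Pinf F) a -> vanishes_at q f (P0 F) b ->
  \sum_(P : Bpoint F q) c P * evalP f (val P) = 0.
Proof.
move=> hc hf fa fb; rewrite -[RHS](hc [ffun P : Bpoint F q => evalP f (val P)]).
  by apply: eq_bigr => P _; rewrite ffunE.
by exists f; split=> // P; rewrite ffunE.
Qed.

(** If [f] vanishes on the support except at [P], the orthogonality relation
    reduces to [c P * f(P) = 0]. *)
Lemma dual_code_eval0 (F : finFieldType) q d a b (c : word F q) (f : {mpoly F[3]})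
    (P : Bpoint F q) :
  dual (@code F q d a b) c -> P \in supp c -> f \is d.-homog ->
  vanishes_at q f (Pinf F) a -> vanishes_at q f (P0 F) b ->
  {in supp c :\ P, forall Q, evalP f (val Q) = 0} -> evalP f (val P) = 0.
Proof.
move=> hc; rewrite inE => cP hf fa fb fS.
have := dual_code_sum hc hf fa fb; rewrite (bigD1 P) //= big1 => [|Q QP].
  by rewrite addr0 => /eqP; rewrite mulf_eq0 (negbTE cP) => /eqP.
have [->|cQ] := eqVneq (c Q) 0; first by rewrite mul0r.
by rewrite fS ?mulr0 // !inE QP cQ.
Qed.

(** The two tangents [y] and [z] take care of the scheme, at the cost of two
    degrees; powers of [y] fill up the remaining degree, as [y] has no zero
    on [B]. *)
Lemma dual_code_eval0_low (F : finFieldType) q a b e (c : word F q) (h : {mpoly F[3]})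
    (P : Bpoint F q) :
  dual (@code F q (q - 1) a b) c -> P \in supp c ->
  (a <= q.+1)%N -> (b <= q.+1)%N -> (e + 2 < q)%N -> h \is e.-homog ->
  {in supp c :\ P, forall Q, evalP h (val Q) = 0} -> evalP h (val P) = 0.
Proof.
move=> hc cP aq bq eq hh hS; have q1 : (1 < q)%N by lia.
pose k := (q - 3 - e)%N.
pose f : {mpoly F[3]} := 'X_1 ^+ k * h * 'X_1 * 'X_ord_max.
have hf : f \is (q - 1).-homog.
  rewrite (_ : q - 1 = k + e + 1 + 1)%N; last by rewrite /k; lia.
  by do ?[apply: dhomogM => //]; rewrite ?dhomogXi ?dhomogXiXn.
have : evalP f (val P) = 0.
  apply: (dual_code_eval0 hc cP hf).
  - exact: vanishes_atMl (vanishes_at_Z _ q1 aq).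
  - rewrite /f mulrAC; exact: vanishes_atMl (vanishes_at_Y _ q1 bq).
  - by move=> Q QS; rewrite !evalPM hS // mulr0 !mul0r.
move/eqP; rewrite /f !evalPM evalPXn !mulf_eq0 expf_eq0.
have q0 : (0 < q)%N by lia.
by rewrite !(negbTE (B_Y_neq0 _ q0)) !(negbTE (B_Z_neq0 _ q0)) andbF !orbF => /eqP.
Qed.

(** With at most [q - 2] points, one line through each point but one has total
    degree at most [q - 3]. *)
Lemma dual_weight_gt (F : finFieldType) q (c : word F q) a b :
  dual (@code F q (q - 1) a b) c ->
  (2 < q)%N -> (a <= q.+1)%N -> (b <= q.+1)%N -> (exists P, c P != 0) ->
  (q - 2 < #|supp c|)%N.
Proof.
move=> hc q2 aq bq [P cP]; have {}cP : P \in supp c by rewrite inE.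
rewrite ltnNge; apply/negP => le_s.
pose T : seq (P2 F) := [seq val Q | Q <- enum (supp c :\ P)].
have sT : (size T).+1 = #|supp c| by rewrite size_map -cardE (cardsD1 P (supp c)) cP.
have [Q QT|h [hh hT hP _]] := @lines_product F (Pinf F) (val P) (fun=> True) T.
  have neQP : Q != val P.
    by case/mapP: QT => R; rewrite mem_enum !inE => /andP[RP _] ->; rewrite val_eqE.
  by have [l [hl lQ lP]] := line_separating neQP; exists l.
case/eqP: hP; apply: (dual_code_eval0_low hc cP aq bq _ hh).
  by move: le_s; rewrite -sT; clear -q2; move: (size T) => n; lia.
by move=> Q QS; apply: hT; apply: map_f; rewrite mem_enum.
Qed.

(** A line through two points of the support that misses a third one saves a
    degree over using one line for each point. *)
Lemma supp_collinear (F : finFieldType) q (c : word F q) a b :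
  dual (@code F q (q - 1) a b) c ->
  (a <= q.+1)%N -> (b <= q.+1)%N -> (1 < #|supp c| < q)%N ->
  exists l : {mpoly F[3]},
    [/\ l \is 1.-homog, l != 0 & {in supp c, forall P, evalP l (val P) = 0}].
Proof.
move=> hc aq bq /andP[/card_gt1P[A [A' [cA cA' neA]]] cq].
have neAval : val A != val A' by rewrite val_eqE.
have [l [hl l0 lA lA']] := line_through neAval.
exists l; split=> // P cP; apply/eqP; apply/negPn/negP => lP.
have PA : P != A by apply: contraNneq lP => ->; rewrite lA.
have PA' : P != A' by apply: contraNneq lP => ->; rewrite lA'.
pose T : seq (P2 F) := [seq val Q | Q <- enum (supp c :\ A :\ A' :\ P)].
have sT : (size T).+3 = #|supp c|.
  have A'A : A' \in supp c :\ A by rewrite in_setD1 eq_sym neA.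
  have PAA' : P \in supp c :\ A :\ A' by rewrite in_setD1 PA' in_setD1 PA.
  rewrite size_map -cardE (cardsD1 A (supp c)) cA (cardsD1 A' (supp c :\ A)) A'A.
  by rewrite (cardsD1 P (supp c :\ A :\ A')) PAA' !add1n.
have [Q QT|h [hh hT hP _]] := @lines_product F (Pinf F) (val P) (fun=> True) T.
  have neQP : Q != val P.
    by case/mapP: QT => R; rewrite mem_enum !inE => /andP[RP _] ->; rewrite val_eqE.
  by have [m [hm mQ mP]] := line_separating neQP; exists m.
suff /eqP : evalP (l * h) (val P) = 0.
  by rewrite evalPM mulf_eq0 (negbTE lP) (negbTE hP).
apply: (dual_code_eval0_low hc cP aq bq _ (dhomogM hl hh)).
  by move: cq; rewrite -sT; move: (size T) => n; rewrite add1n addn2.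
move=> Q; rewrite in_setD1 evalPM => /andP[QP cQ].
have [->|QA] := eqVneq Q A; first by rewrite lA mul0r.
have [->|QA'] := eqVneq Q A'; first by rewrite lA' mul0r.
by rewrite hT ?mulr0 // map_f // mem_enum in_setD1 QP in_setD1 QA' in_setD1 QA.
Qed.

(** The join of [Pinf] with a point [Q] of [l] other than [P] is the member
    through [Pinf] of the pencil spanned by [l] and any line that passes through
    [Q] but not through [P]; since [l] contains [P] and the other line does not,
    neither does that member. *)
Lemma supp_line_Pinf (F : finFieldType) q (c : word F q) a b (l : {mpoly F[3]}) :
  dual (@code F q (q - 1) a b) c -> (1 < q)%N -> #|supp c| = (q - 1)%N ->
  (a <= q - 2)%N -> (b <= q.+1)%N ->
  l \is 1.-homog -> {in supp c, forall P, evalP l (val P) = 0} ->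
  evalP l (Pinf F) = 0.
Proof.
move=> hc q1 s_eq aq bq hl lS; apply/eqP; apply/negPn/negP => lPi.
have [P cP] : exists P, P \in supp c by apply/card_gt0P; rewrite s_eq; lia.
pose T : seq (P2 F) := [seq val Q | Q <- enum (supp c :\ P)].
have sT : (size T).+1 = (q - 1)%N.
  by rewrite -s_eq size_map -cardE (cardsD1 P (supp c)) cP.
pose C (m : {mpoly F[3]}) := evalP m (Pinf F) = 0.
have [_ /mapP[Q QS ->]|h [hh hT hP hPi]] := @lines_product F (Pinf F) (val P) C T.
  move: QS; rewrite mem_enum in_setD1 => /andP[QP cQ].
  have neQP : val Q != val P by rewrite val_eqE.
  have [m [hm mQ mP]] := line_separating neQP.
  exists (m - (evalP m (Pinf F) / evalP l (Pinf F)) *: l); split.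
  - by apply: rpredB => //; apply: rpredZ.
  - by rewrite /C !evalPE divfK // subrr.
  - by rewrite !evalPE mQ lS // mulr0 subrr.
  - by rewrite !evalPE (lS P) // mulr0 subr0.
have hf : h * 'X_1 \is (q - 1).-homog.
  by rewrite -sT -[(size T).+1]addn1; apply: dhomogM => //; apply: dhomogXi.
suff /eqP : evalP (h * 'X_1) (val P) = 0.
  by rewrite evalPM mulf_eq0 (negbTE hP) (negbTE (B_Y_neq0 _ _)) //; lia.
apply: (dual_code_eval0 hc cP hf).
- rewrite mulrC; apply: vanishes_atMl; apply: vanishes_at_pow.
  by apply: point_ideal_pow_le (hPi _) => //; lia.
- exact: vanishes_atMl (vanishes_at_Y _ q1 bq).
- by move=> Q QS; rewrite evalPM hT ?mul0r // map_f // mem_enum.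
Qed.

(** * A codeword on the line [x = 0] *)

(** For even [q], [(-1) ^ #|F| = -1] forces [1 = -1]. *)
Lemma neg1_exp_card (F : finFieldType) q : #|F| = (q ^ 2)%N -> (-1) ^+ q = -1 :> F.
Proof.
move=> cF; have := expf_card (-1 : F); rewrite cF.
by rewrite -[in LHS]signr_odd -[in X in _ -> X]signr_odd oddX /=.
Qed.

(** As [(-1)^(q+1) = 1], the polynomial [X^(q-1) + 1] divides
    [X^(q^2-1) - 1], which splits over [F].  The roots are the nonzero solutions
    of [y^q + y = 0], that is, the points of [B] on [x = 0]. *)
Lemma trace_zero_roots (F : finFieldType) q : (1 < q)%N -> #|F| = (q ^ 2)%N ->
  exists rs : seq F, [/\ uniq rs, size rs = (q - 1)%N &
    {in rs, forall y, y ^+ (q - 1) = -1}].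
Proof.
move=> q1 cF; pose p : {poly F} := 'X^(q - 1) - (-1)%:P.
have szp : size p = (q - 1).+1.
  by rewrite size_XnsubC //; lia.
have /dvdp_prod_XsubC[m pE] : p %| \prod_(x <- enum F) ('X - x%:P).
  rewrite big_enum -finField_genPoly cF.
  have -> : 'X^(q ^ 2) - 'X = ('X^(q - 1) ^+ q.+1 - (-1)%:P ^+ q.+1) * 'X :> {poly F}.
    have N1 : (-1) ^+ q.+1 = 1 :> F by rewrite exprS neg1_exp_card // mulrNN mulr1.
    rewrite -polyC_exp N1 mulrBl mul1r.
    rewrite -exprM -exprSr; congr ('X^_ - _).
    have -> : (q = (q - 1).+1)%N by lia.
    by rewrite subn1 /=; nia.
  by rewrite subrXX -mulrA dvdp_mulr.
exists (mask m (enum F)); split.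
- by rewrite mask_uniq // enum_uniq.
- by have := eqp_size pE; rewrite szp size_prod_XsubC => -[].
- move=> y ys; apply/eqP; rewrite -subr_eq0.
  have : root p y by rewrite (eqp_root pE) root_prod_XsubC.
  by rewrite /root !hornerE.
Qed.

(** At a coordinate point every monomial of degree [d] vanishes except
    [X_k ^ d]. *)
Lemma mcoeff_pure_power (L : fieldType) d (f : {mpoly L[3]}) (k : 'I_3) (P : P2 L) :
  f \is d.-homog -> (forall i, val P 0 i = (i == k)%:R) ->
  f@_(U_(k) *+ d) = evalP f P.
Proof.
move=> /dhomogP hf Pk; rewrite /evalP mevalE.
have term m : m \in msupp f -> \prod_i (val P) 0 i ^+ m i = (m == U_(k) *+ d)%MM%:R.
  move=> /hf /= dm; case: eqP => [->|neq].
    rewrite big1 // => i _; rewrite Pk mulmnE mnm1E eq_sym.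
    by case: eqP; rewrite ?expr1n ?mul0n ?expr0.
  have [i /andP[ik mi]|all0] := pickP (fun i => (i != k) && (m i != 0)%N).
    by rewrite (bigD1 i) //= Pk (negbTE ik) expr0n (negbTE mi) mul0r.
  case: neq; apply/mnmP => i; rewrite mulmnE mnm1E eq_sym.
  have m0 j : j != k -> m j = 0%N.
    by move=> jk; have := all0 j; rewrite jk => /negbFE/eqP.
  have [->|ik] := eqVneq i k; last by rewrite m0 // mul0n.
  by rewrite mul1n -dm mdegE (bigD1 k) //= big1 ?addn0 // => j /m0.
rewrite (eq_big_seq (fun m => f@_m * (m == U_(k) *+ d)%MM%:R)); last first.
  by move=> m /term ->.
have [kf|kf] := boolP ((U_(k) *+ d)%MM \in msupp f).
  rewrite (bigD1_seq _ kf) ?msupp_uniq //= eqxx mulr1 big1 ?addr0 // => m.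
  by move=> /negbTE ->; rewrite mulr0.
rewrite (memN_msupp_eq0 kf) big1_seq // => m /andP[_ mf].
by case: eqP => [E|]; rewrite ?mulr0 //; move: kf; rewrite -E mf.
Qed.

(** On the points [(0 : y : 1)] a form of the code is a combination of the
    monomials [y^j] with [0 < j < q - 1]: the pure powers of [y] and [z] drop out
    because the form vanishes at [Pinf] and at [P0].  These are [q - 2]
    monomials on [q - 1] points, so the values satisfy a linear relation. *)
Lemma dual_weight_line (F : finFieldType) q a b : #|F| = (q ^ 2)%N -> (1 < q)%N ->
  (0 < a)%N -> (0 < b)%N ->
  exists c : word F q, [/\ dual (@code F q (q - 1) a b) c, (exists P, c P != 0) &
    (#|supp c| <= q - 1)%N].
Proof.
move=> cF q1 a0 b0; have [rs [rs_uniq rs_size rsE]] := trace_zero_roots q1 cF.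
have q0 : (0 < q)%N by lia.
pose y (i : 'I_(q - 1)) := rs`_i.
have yE i : y i ^+ (q - 1) = -1 by apply/rsE/mem_nth; rewrite rs_size.
have y_neq0 i : y i != 0.
  apply: contra_eq_neq (yE i) => ->; rewrite expr0n subn_eq0 leqNgt q1.
  by rewrite eq_sym oppr_eq0 oner_eq0.
pose v i : 'rV[F]_3 := \row_j [:: 0; y i; 1]`_j.
have v_norm i : normalized (v i).
  apply/existsP; exists ord_max; rewrite mxE eqxx /=; apply/forallP => j.
  by rewrite ltnNge -ltnS ltn_ord.
pose pt0 i : P2 F := Sub (v i) (v_norm i).
have pt0E i j : val (pt0 i) 0 j = [:: 0; y i; 1]`_j by rewrite SubK mxE.
have pt0B i : pt0 i \in B F q.
  have yq : y i ^+ q = - y i by rewrite -[q in LHS](subnK q0) addn1 exprS yE mulrN1.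
  rewrite inE on_X_eq !pt0E /= !mulr1 expr1n expr0n mulr1 yq addNr eqxx /=.
  apply/andP; split; apply/eqP => /(congr1 (fun P : P2 F => val P)) /rowP E.
    by have /eqP := E ord_max; rewrite pt0E valPinf oner_eq0.
  by have /eqP := E 1; rewrite pt0E valP0 (negbTE (y_neq0 i)).
pose pt i : Bpoint F q := Sub (pt0 i) (pt0B i).
have pt_inj : injective pt.
  move=> i j E; have := congr1 (fun P : Bpoint F q => val (val P) 0 1) E.
  rewrite !pt0E /= => /eqP.
  by rewrite nth_uniq ?rs_size // => /eqP/val_inj.
pose M := \matrix_(i < q - 1, j < q - 2) y i ^+ j.+1.
have /rowV0Pn[u /sub_kermxP uM u0] : kermx M != 0.
  rewrite -mxrank_eq0 mxrank_ker subn_eq0 -ltnNge.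
  by apply: leq_ltn_trans (rank_leq_col M) _; lia.
have uE j : (0 < j < q - 1)%N -> \sum_i u 0 i * y i ^+ j = 0.
  move=> /andP[j0 jq]; have jq' : (j.-1 < q - 2)%N by lia.
  have := congr1 (fun w : 'rV_(q - 2) => w 0 (Ordinal jq')) uM.
  rewrite !mxE => uM0; rewrite -[RHS]uM0.
  by apply: eq_bigr => i _; rewrite mxE /= prednK.
pose c : word F q := [ffun P => \sum_i u 0 i * (P == pt i)%:R].
have c_pt i : c (pt i) = u 0 i.
  rewrite ffunE (bigD1 i) //= eqxx mulr1 big1 ?addr0 // => j ji.
  by rewrite (inj_eq pt_inj) eq_sym (negbTE ji) mulr0.
exists c; split.
- move=> w [f [hf fa fb wE]].
  have fPinf : evalP f (Pinf F) = 0 by apply: vanishes_at_eval0 fa; rewrite ?Pinf_on_X.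
  have fP0 : evalP f (P0 F) = 0 by apply: vanishes_at_eval0 fb; rewrite ?P0_on_X.
  have -> : \sum_P c P * w P = \sum_i u 0 i * evalP f (pt0 i).
    under eq_bigr => P _ do rewrite ffunE mulr_suml.
    rewrite exchange_big; apply: eq_bigr => i _ /=.
    rewrite (bigD1 (pt i)) //= eqxx mulr1 wE big1 ?addr0 // => P /negbTE ->.
    by rewrite mulr0 mul0r.
  under eq_bigr => i _ do rewrite /evalP mevalE mulr_sumr.
  rewrite exchange_big big1_seq //= => m mf.
  have dm : (m 0%R + m 1%R + m ord_max = q - 1)%N.
    have /= <- := dhomogP _ _ _ hf m mf.
    rewrite mdegE !big_ord_recr big_ord0 /= add0n.
    by congr (m _ + m _ + m _)%N; apply: val_inj.
  have monE i : \prod_j val (pt0 i) 0 j ^+ m j = (m 0 == 0%N)%:R * y i ^+ m 1.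
    rewrite !big_ord_recr big_ord0 /= mul1r !pt0E /= expr1n mulr1 expr0n.
    by congr ((m _ == _)%:R * _ ^+ m _); apply: val_inj.
  transitivity ((\sum_i u 0 i * y i ^+ m 1) * (f@_m * (m 0 == 0%N)%:R)).
    by rewrite mulr_suml; apply: eq_bigr => i _; rewrite monE; ring.
  have [m0|_] := eqVneq (m 0) 0%N; last by rewrite !mulr0.
  have pure (k : 'I_3) : m 0 = ((k == 0%R) * (q - 1))%N ->
      m 1 = ((k == 1%R) * (q - 1))%N ->
      m = (U_(k) *+ (q - 1))%MM.
    move=> E0 E1; apply/mnmP => i; rewrite mulmnE mnm1E.
    by case: (ord3P i) => -> //; case: (ord3P k) dm E0 E1 => -> /=; lia.
  have [m1|m1] := posnP (m 1).
    by rewrite (pure ord_max) // (mcoeff_pure_power hf (@valP0 F)) fP0 mul0r mulr0.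
  have [m1q|m1q] := ltnP (m 1) (q - 1); first by rewrite uE ?m1 // mul0r.
  rewrite (pure 1) ?(mcoeff_pure_power hf (@valPinf F)) ?fPinf ?mul0r ?mulr0 //.
  by rewrite mul1n; move: dm m1q; lia.
- have /rV0Pn[i ui] := u0.
  by exists (pt i); rewrite c_pt.
- have sub : supp c \subset pt @: 'I_(q - 1).
    apply/subsetP => P; rewrite inE ffunE; apply: contraNT => nP.
    rewrite big1 // => i _; case: eqP nP => [->|_ _]; last by rewrite mulr0.
    by rewrite imset_f.
  apply: leq_trans (subset_leq_card sub) _; apply: leq_trans (leq_imset_card _ _) _.
  by rewrite card_ord.
Qed.

Theorem theorem23 (F : finFieldType) (p k q : nat)
  (p_prime : prime p) (k_gt0 : (0 < k)%N) (q_def : q = (p ^ k)%N)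
  (cardF : #|F| = (q ^ 2)%N) (q_gt : (2 < q - 1)%N)
  (a b : nat) (ha : (1 <= a)%N) (hab : (a <= b)%N) (hb : (b <= q)%N)
  (hdeg_lo : (q%:Z ^+ 2 - q%:Z - 2 <=
              (q%:Z - 1) * (q%:Z + 1) - a%:Z - b%:Z)%R)
  (hdeg_hi : ((q%:Z - 1) * (q%:Z + 1) - a%:Z - b%:Z <=
              (q%:Z ^+ 2 - q%:Z - 2) + q%:Z)%R)
  (D : {ffun P2 F -> int})
  (D_def : D = point_div (Pinf F) *~ ((q%:Z - 1) * (q%:Z + 1))
               - point_div (Pinf F) *~ a%:Z - point_div (P0 F) *~ b%:Z)
  (D_inf : forall n : int, ~ lin_equiv q D (point_div (Pinf F) *~ n))
  (D_0 : forall n : int, ~ lin_equiv q D (point_div (P0 F) *~ n))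
  (delta : nat)
  (delta_min : is_min_distance (dual (@code F q (q - 1)%N a b)) delta)
  (c : word F q)
  (c_min : min_weight_codeword (dual (@code F q (q - 1)%N a b)) c)
  (pts : delta.-tuple (Bpoint F q))
  (pts_uniq : uniq pts) (pts_supp : pts =i supp c) :
  [\/ collinear [:: P0 F, Pinf F & map val pts],
      collinear (Pinf F :: map val pts)
    | collinear (P0 F :: map val pts)].
Proof.
have [q_gt1 q_gt2] : (1 < q)%N /\ (2 < q)%N by lia.
have ab_le : (a + b <= q.+1)%N.
  have sq : q%:Z ^+ 2 = (q%:Z - 1) * (q%:Z + 1) + 1 by ring.
  by move: hdeg_lo; rewrite sq; move: (_ * _) => d; lia.
have a_le : (a <= q.+1)%N by lia.
have b_le : (b <= q.+1)%N by lia.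
have [c_dual c_neq0 c_le] := c_min.
have [c' [c'_dual c'_neq0 c'_wt]] := dual_weight_line cardF q_gt1 ha (leq_trans ha hab).
have wt_ge := dual_weight_gt c_dual q_gt2 a_le b_le c_neq0.
have wt : #|supp c| = (q - 1)%N.
  by have := leq_trans (c_le _ c'_dual c'_neq0) c'_wt; lia.
have [l [l_lin l_neq0 lS]] : exists l : {mpoly F[3]},
    [/\ l \is 1.-homog, l != 0 & {in supp c, forall P, evalP l (val P) = 0}].
  by apply: supp_collinear c_dual a_le b_le _; rewrite wt; lia.
apply: Or32; exists l; split=> // P; rewrite inE => /orP[/eqP ->|].
  by apply: supp_line_Pinf c_dual q_gt1 wt _ b_le l_lin lS; lia.
by case/mapP => Q; rewrite pts_supp => cQ ->; apply: lS.
Qed.
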